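(* Let $p$ be a prime, let $G$ be a finite group, and let $D$ be the intersection of all maximal $p$-nilpotent subgroups of $G$. Then $D$ is the largest normal subgroup of $G$ satisfying $O_{p'}(D)=O_{p'}(G)$ and $D/O_{p'}(G)\le Z_{\infty}(G/O_{p'}(G))$.
   Context: All groups are finite. A maximal $p$-nilpotent subgroup of $G$ is a subgroup that is maximal, with respect to inclusion, among the $p$-nilpotent subgroups of $G$ (it may be equal to $G$). $Z_{\infty}(X)$ denotes the hypercentre of the group $X$, i.e. the last term of its upper central series. *)

(* Defs.v *)
From mathcomp Require Import all_boot all_fingroup all_solvable.

Set Implicit Arguments.
Unset Strict Implicit.
Unset Printing Implicit Defensive.

Import GroupScope.

Section Defs.

Variable gT : finGroupType.
Implicit Types (p n : nat) (G : {group gT}).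

(* A normal p-complement of H is a normal subgroup of p'-order and p-power    *)
(* index, i.e., a normal Hall p'-subgroup.                                    *)
Definition p_nilpotent p (H : {set gT}) : bool :=
  [exists K : {group gT}, (K <| H) && p^'.-Hall(H) K].

Definition max_p_nilpotent p (G : {set gT}) (M : {group gT}) : bool :=
  [max M | (M \subset G) && p_nilpotent p M].

Definition max_p_nilpotent_cap p (G : {set gT}) : {set gT} :=
  \bigcap_(M : {group gT} | max_p_nilpotent p G M) M.

Canonical max_p_nilpotent_cap_group p (G : {set gT}) :=
  Eval hnf in [group of max_p_nilpotent_cap p G].

(* The upper central series of G is stationary from index #|G| on: see        *)
(* hypercentre_last and ucn_hypercentre.                                      *)
Definition hypercentre (G : {set gT}) : {set gT} := 'Z_(#|G|)(G).

Canonical hypercentre_group G := Eval hnf in [group of hypercentre G].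

Lemma ucn_stationary m n G :
  'Z_m.+1(G) = 'Z_m(G) -> m <= n -> 'Z_n(G) = 'Z_m(G).
Proof.
move=> eqZ /subnK<-; elim: (n - m) => // k IHk.
by rewrite addSn ucnSn IHk -ucnSn.
Qed.

Lemma ucn_hypercentre n G : #|G| <= n -> 'Z_n(G) = hypercentre G.
Proof.
suffices [m le_mG eqZ]: exists2 m, m <= #|G| & 'Z_m.+1(G) = 'Z_m(G).
  by move=> le_Gn; rewrite /hypercentre !(ucn_stationary eqZ) // (leq_trans le_mG).
have: forall k, (exists2 m, m <= k & 'Z_m.+1(G) = 'Z_m(G)) \/ k < #|'Z_k(G)|.
  elim=> [|k [[m le_mk eqZ] | ltkZ]]; first by right; rewrite cardG_gt0.
    by left; exists m; first exact: leqW.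
  have [eqZ | neqZ] := eqVneq 'Z_k.+1(G) 'Z_k(G); first by left; exists k.
  right; apply: leq_ltn_trans ltkZ _; apply: proper_card.
  by rewrite properEneq eq_sym neqZ ucn_subS.
by move/(_ #|G|)=> [//|]; rewrite ltnNge subset_leq_card ?ucn_sub.
Qed.

Lemma hypercentre_last n G : 'Z_n(G) \subset hypercentre G.
Proof.
by rewrite -(@ucn_hypercentre (maxn n #|G|)) ?leq_maxr // ucn_sub_geq ?leq_maxl.
Qed.

End Defs.

(* Main.v *)
Require Import Defs.
From mathcomp Require Import all_boot all_fingroup all_solvable.

Set Implicit Arguments.
Unset Strict Implicit.
Unset Printing Implicit Defensive.

(** Write O for O_p'(G) and D for the intersection of the maximal p-nilpotent
subgroups.  A subgroup N of G lies in D as soon as NH is p-nilpotent for every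
p-nilpotent subgroup H of G (sub_max_p_nilpotent_cap), and p-nilpotency does
not change on factoring out a normal p'-subgroup (p_nilpotent_pquotient).
Together these give O <= D, hence O_p'(D) = O, as D is normal in G.

Everything else rests on one equivalence: a normal p-subgroup P of a group X
is hypercentral if and only if every p'-element of X centralises it.

- If the p'-elements centralise P, then X = C_X(P)S for a Sylow p-subgroup S,
  so commutators of elements of P with X are commutators with S, and P climbs
  the upper central series of X as fast as that of the nilpotent group S
  (sub_hypercentre_p'cent).

- If P is hypercentral and y is a p'-element, then y generates a nilpotent
  group together with the hypercentre, and in a nilpotent group elements of
  coprime orders commute (hypercentre_cent_p'elt).

For D/O <= Z_oo(G/O): a p'-element y of G lies in some maximal p-nilpotent M,
and even in O_p'(M).  As D is normal in M, [y, D] lies in O_p'(M) and in D,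
hence in O_p'(D) = O.  So the p'-elements of G/O centralise D/O, which is a
p-group because D is p-nilpotent.

For the maximality of D: let N/O be hypercentral in G/O.  It is nilpotent with
trivial p'-core, hence a p-group, so it is centralised by the normal
p-complement K of any p-nilpotent subgroup H of G/O.  Then K is also a normal
p-complement of (N/O)H, which is therefore p-nilpotent, and N <= D by the
criterion above. *)

Import GroupScope.

(** * p-nilpotent groups *)

Section PNilpotent.

Variables (gT : finGroupType) (p : nat).
Implicit Types (G H K O : {group gT}).

Lemma p_nilpotentE G : p_nilpotent p G = p^'.-Hall(G) 'O_p^'(G).
Proof.
apply/existsP/idP=> [[K /andP[nsKG hallK]] | hallO].
  by rewrite (normal_Hall_pcore hallK nsKG).
by exists 'O_p^'(G)%G; rewrite pcore_normal.
Qed.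

Lemma p_nilpotentP G :
  reflect (exists K, [/\ K <| G, p^'.-group K & p.-group (G / K)])
          (p_nilpotent p G).
Proof.
apply: (iffP existsP) => -[K].
  case/andP=> nsKG /and3P[_ p'K pGK]; exists K; split=> //.
  by rewrite /pgroup card_quotient ?normal_norm // -[_.-nat _]pnatNK.
case=> nsKG p'K pGK; exists K; rewrite nsKG /pHall normal_sub // p'K /=.
by rewrite pnatNK -card_quotient ?normal_norm.
Qed.

Lemma p_nilpotentS G H : H \subset G -> p_nilpotent p G -> p_nilpotent p H.
Proof.
move=> sHG /p_nilpotentP[K [nsKG p'K pGK]]; apply/p_nilpotentP.
have nKH := subset_trans sHG (normal_norm nsKG).
exists (K :&: H)%G; split; first by rewrite /= setIC (normalGI sHG).
  exact: pgroupS (subsetIl _ _) p'K.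
by rewrite (isog_pgroup _ (second_isog nKH)) (pgroupS _ pGK) ?quotientS.
Qed.

Lemma p_nilpotentJ H x : p_nilpotent p (H :^ x) = p_nilpotent p H.
Proof. by rewrite !p_nilpotentE pcoreJ pHallJ2. Qed.

Lemma p'group_p_nilpotent G : p^'.-group G -> p_nilpotent p G.
Proof.
move=> p'G; rewrite p_nilpotentE pcore_pgroup_id //.
by rewrite /pHall subxx p'G indexgg.
Qed.

End PNilpotent.

Section PNilpotentQuotient.

Variables (gT : finGroupType) (p : nat).
Implicit Types (G H K O : {group gT}).

Lemma p_nilpotent_quotient G H :
  G \subset 'N(H) -> p_nilpotent p G -> p_nilpotent p (G / H).
Proof.
move=> nHG /existsP[K /andP[nsKG hallK]]; apply/existsP.
exists (K / H)%G; rewrite quotient_normal //= quotient_pHall //.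
exact: subset_trans (normal_sub nsKG) nHG.
Qed.

(** p-nilpotency lifts to G because the preimage of a p-complement under
a quotient by a p'-group is again a p'-group. *)
Lemma p_nilpotent_pquotient O G :
  O <| G -> p^'.-group O -> p_nilpotent p (G / O) = p_nilpotent p G.
Proof.
move=> nsOG p'O; rewrite !p_nilpotentE pquotient_pcore // pquotient_pHall //.
by rewrite (normalS _ _ nsOG) ?pcore_sub ?pcore_max.
Qed.

End PNilpotentQuotient.

(** * Normal p-subgroups of the hypercentre *)

Section Hypercentre.

Variables (gT : finGroupType) (p : nat).
Implicit Types (G H K P C : {group gT}).

(** Otherwise Cauchy's theorem gives an element of prime order q <> p in G / C;
it is the image of the p'-part of any of its representatives, which lies
in C. *)
Lemma pgroup_quotient_p'elt G C :
    C <| G -> {in G, forall y, p^'.-elt y -> y \in C} ->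
  p.-group (G / C).
Proof.
move=> nsCG cp'; apply/pgroupP=> q q_pr /(Cauchy q_pr)[xb].
case/morphimP=> x nCx Gx -> {xb} ox; apply/idPn=> p'q.
have p'x: p^'.-elt (coset C x) by rewrite /p_elt ox pnatE.
have x1: coset C x = 1.
  rewrite -(constt_p_elt p'x) -morph_constt //= coset_id //.
  by apply: cp'; [rewrite groupX | apply: p_elt_constt].
by move: q_pr; rewrite -ox /= x1 order1.
Qed.

(** Since G = C_G(P) S for any Sylow p-subgroup S, commutators of P with G are
commutators with S; by induction P meets the n-th term of the upper central
series of S inside that of G, and for large n the former is S. *)
Lemma sub_hypercentre_p'cent G P :
    P <| G -> p.-group P -> {in G, forall y, p^'.-elt y -> y \in 'C(P)} ->
  P \subset hypercentre G.
Proof.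
move=> nsPG pP cPp'; have [sPG nPG] := andP nsPG.
have [S sylS sPS] := Sylow_superset sPG pP.
have [sSG pS _] := and3P sylS.
have nsCG: 'C_G(P) <| G by rewrite /normal subsetIl normsI ?normG ?norms_cent.
have defG: G \subset 'C_G(P) * S.
  rewrite -quotientSK ?normal_norm //.
  have pGC: p.-group (G / 'C_G(P)).
    by apply: pgroup_quotient_p'elt => // y Gy p'y; rewrite inE Gy cPp'.
  have nCS := subset_trans sSG (normal_norm nsCG).
  by rewrite (pHall_id (quotient_pHall nCS sylS) pGC).
have sPZ n: P :&: 'Z_n(S) \subset 'Z_n(G).
  elim: n => [|n IHn]; first by rewrite !ucn0 subsetIr.
  apply/subsetP=> x /setIP[Px]; rewrite !ucnSnR !inE (subsetP sPG) //=.
  case/andP=> Sx sxZ; rewrite gen_subG.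
  apply/subsetP=> _ /imset2P[_ g /set1P-> Gg ->].
  have /mulsgP[c s /setIP[_ Cc] Ss ->] := subsetP defG g Gg.
  have /commgP/eqP cxc: commute x c by apply: commute_sym; apply: (centP Cc).
  (* [x, cs] = [x, s][x, c]^s, and [x, c] = 1 as x is in P. *)
  rewrite commgMJ cxc conj1g mulg1 (subsetP IHn) // inE.
  rewrite (subsetP sxZ) ?mem_commg ?set11 // andbT.
  rewrite (subsetP (_ : [~: P, G] \subset P)) ?commg_subl //.
  by rewrite mem_commg // (subsetP sSG).
have /ucnP[n defZ] := pgroup_nil pS.
apply: subset_trans (hypercentre_last n G).
by rewrite -(setIidPl sPS) -defZ sPZ.
Qed.

Lemma setI_ucn_sub n G H : H \subset G -> 'Z_n(G) :&: H \subset 'Z_n(H).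
Proof.
move=> sHG; elim: n => [|n IHn]; first by rewrite !ucn0 subsetIl.
apply/subsetP=> x; rewrite !ucnSnR !inE => /andP[/andP[_ sxZ] Hx].
rewrite Hx /= (subset_trans _ IHn) // subsetI (subset_trans _ sxZ) ?commgS //=.
by rewrite (subset_trans (commSg _ _) (der1_subG _)) ?sub1set.
Qed.

(** The group H generated by y and the hypercentre Z of G is nilpotent: its
quotient by Z is cyclic, and Z is contained in a term of the upper central
series of H.  Elements of coprime orders of H therefore commute. *)
Lemma hypercentre_cent_p'elt G P y :
    p.-group P -> P \subset hypercentre G -> y \in G -> p^'.-elt y ->
  y \in 'C(P).
Proof.
move=> pP sPZ Gy p'y; pose Z := hypercentre G; pose H := (Z <*> <[y]>)%G.
have sZG: Z \subset G := ucn_sub _ _.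
have syG: <[y]> \subset G by rewrite cycle_subG.
have nZy: <[y]> \subset 'N(Z) := subset_trans syG (ucn_norm _ _).
have sHG: H \subset G by rewrite join_subG sZG.
have sZH: Z \subset 'Z_#|G|(H).
  apply: subset_trans (setI_ucn_sub _ sHG).
  by rewrite subsetI subxx joing_subl.
have nilH: nilpotent H.
  (* One step above the term containing Z, since H / Z is abelian. *)
  apply/ucnP; exists #|G|.+1; apply/eqP; rewrite eqEsubset ucn_sub /=.
  apply/subsetP=> x Hx; rewrite ucnSnR inE Hx /=.
  apply: subset_trans sZH; apply: subset_trans (_ : H^`(1) \subset _).
    by rewrite commSg ?sub1set.
  rewrite der1_min ?join_subG ?normG //= quotientYidl //.
  by rewrite quotient_abelian ?cycle_abelian.
rewrite -cycle_subG; apply: sub_nilpotent_cent2 nilH _ _ _.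
- exact: subset_trans sPZ (joing_subl _ _).
- exact: joing_subr.
- exact: pnat_coprime pP p'y.
Qed.

(** A subgroup of the hypercentre is nilpotent, hence the product of its p-core
and its p'-core; the latter is contained in that of G. *)
Lemma normal_sub_hypercentre_pgroup G P :
    P <| G -> 'O_p^'(G) = 1 -> P \subset hypercentre G -> p.-group P.
Proof.
move=> nsPG O1 sPZ; have nilP: nilpotent P.
  exact: nilpotentS sPZ (ucn_nilpotent _ _).
have /dprodP[_ defP _ _] := nilpotent_pcoreC p nilP.
rewrite -defP -[in X in _ * X](pcore_setI_normal _ nsPG) O1.
by rewrite (setIidPl (sub1G _)) mulg1 pcore_pgroup.
Qed.

(** The normal p-complement K of H centralises P, so it is normal in PH, and
the quotient is the product of the p-groups PK/K and H/K. *)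
Lemma p_nilpotent_joing_hypercentre G P H :
    P <| G -> p.-group P -> P \subset hypercentre G ->
    H \subset G -> p_nilpotent p H ->
  p_nilpotent p (P <*> H).
Proof.
move=> nsPG pP sPZ sHG /p_nilpotentP[K [nsKH p'K pHK]].
have nPH := subset_trans sHG (normal_norm nsPG).
have [sKH nKH] := andP nsKH.
have cPK: P \subset 'C(K).
  rewrite centsC; apply/subsetP=> y Ky.
  apply: hypercentre_cent_p'elt pP sPZ _ (mem_p_elt p'K Ky).
  exact: subsetP sHG y (subsetP sKH y Ky).
have nKP := subset_trans cPK (cent_sub K).
apply/p_nilpotentP; exists K; split=> //.
  by rewrite /normal (subset_trans sKH) ?joing_subr //= join_subG nKP.
by rewrite /= norm_joinEr // quotientMl // pgroupM quotient_pgroup.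
Qed.

End Hypercentre.

(** * The intersection of the maximal p-nilpotent subgroups *)

Section MaxPNilpotent.

Variables (gT : finGroupType) (p : nat) (G : {group gT}).
Implicit Types (H K M N : {group gT}).
Local Notation D := (max_p_nilpotent_cap p G).
Local Notation O := 'O_p^'(G).

Lemma max_p_nilpotent_exists H :
  H \subset G -> p_nilpotent p H -> {M | max_p_nilpotent p G M & H \subset M}.
Proof.
move=> sHG nilH.
pose nilG M := (M \subset G) && p_nilpotent p M.
by apply: (@maxgroup_exists _ nilG); rewrite /nilG sHG.
Qed.

Lemma max_p_nilpotentP M :
  reflect [/\ M \subset G, p_nilpotent p M
             & forall H, H \subset G -> p_nilpotent p H -> M \subset H -> H :=: M]
          (max_p_nilpotent p G M).
Proof.
apply: (iffP maxgroupP) => [[/andP[sMG nilM] maxM] | [sMG nilM maxM]].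
  by split=> // H sHG nilH sMH; apply: maxM; rewrite ?sHG.
by split=> [|H /andP[]]; [apply/andP | move=> sHG nilH sMH; exact: maxM].
Qed.

(** The join of N with a maximal p-nilpotent subgroup M is p-nilpotent, hence
equal to M. *)
Lemma sub_max_p_nilpotent_cap N :
    N \subset G ->
    (forall H, H \subset G -> p_nilpotent p H -> p_nilpotent p (N <*> H)) ->
  N \subset D.
Proof.
move=> sNG nilN; apply/bigcapsP=> M /max_p_nilpotentP[sMG nilM maxM].
rewrite -(maxM (N <*> M)%G) ?joing_subl ?joing_subr ?join_subG ?sNG //.
exact: nilN.
Qed.

Lemma max_p_nilpotentJ M x :
  x \in G -> max_p_nilpotent p G M -> max_p_nilpotent p G (M :^ x)%G.
Proof.
move=> Gx /max_p_nilpotentP[sMG nilM maxM]; apply/max_p_nilpotentP.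
split=> [||H sHG nilH sMH]; rewrite ?p_nilpotentJ //= ?conj_subG //.
apply: (canRL (conjsgKV x)).
apply: (maxM (H :^ x^-1)%G); rewrite ?p_nilpotentJ ?conj_subG ?groupV //.
by rewrite -sub_conjg.
Qed.

Lemma max_p_nilpotent_cap_normal : D <| G.
Proof.
apply/andP; split.
  have nil1: p_nilpotent p [1 gT] := p'group_p_nilpotent (pgroup1 _ _).
  have [M maxM _] := max_p_nilpotent_exists (sub1G G) nil1.
  by apply: (bigcap_min M) => //; case/max_p_nilpotentP: maxM.
apply/subsetP=> x Gx; rewrite inE; apply/bigcapsP=> M maxM; rewrite sub_conjg.
by rewrite (bigcap_inf (M :^ x^-1)%G) // max_p_nilpotentJ ?groupV.
Qed.

(** If H is p-nilpotent, then so is OH, because OH / O is a quotient of H and O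
is a p'-group. *)
Lemma p'core_sub_max_p_nilpotent_cap : O \subset D.
Proof.
apply: (@sub_max_p_nilpotent_cap 'O_p^'(G)) => [|H sHG nilH].
  exact: pcore_sub.
have nOH: H \subset 'N(O) := subset_trans sHG (gFnorm _ _).
rewrite -(@p_nilpotent_pquotient _ _ 'O_p^'(G)) ?pcore_pgroup //=.
  by rewrite quotientYidl // p_nilpotent_quotient.
by rewrite /normal joing_subl join_subG normG.
Qed.

Lemma p'core_max_p_nilpotent_cap : 'O_p^'(D) = O.
Proof.
have nsDG := max_p_nilpotent_cap_normal.
rewrite -(pcore_setI_normal _ nsDG); apply/setIidPl.
exact: p'core_sub_max_p_nilpotent_cap.
Qed.

(** Choose a maximal p-nilpotent subgroup M containing y.  Its normal
p-complement O_p'(M) contains y, so [y, D] lies in both normal subgroups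
O_p'(M) and D of M, and O_p'(M) meets D in O_p'(D) = O. *)
Lemma max_p_nilpotent_cap_comm_p'elt y :
  y \in G -> p^'.-elt y -> [~: [set y], D] \subset O.
Proof.
move=> Gy p'y; have syG: <[y]> \subset G by rewrite cycle_subG.
have [M maxM] := max_p_nilpotent_exists syG (p'group_p_nilpotent p'y).
rewrite cycle_subG => My; have [sMG nilM _] := max_p_nilpotentP _ maxM.
have sDM: D \subset M by apply: bigcap_inf.
have nDG := normal_norm max_p_nilpotent_cap_normal.
have nsDM: D <| M by rewrite /normal sDM (subset_trans sMG).
have Ky: y \in 'O_p^'(M) by rewrite mem_Hall_pcore // -p_nilpotentE.
rewrite -p'core_max_p_nilpotent_cap -(pcore_setI_normal _ nsDM).
apply: subset_trans (commSg _ (_ : _ \subset 'O_p^'(M))) _.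
  by rewrite sub1set.
rewrite commg_subI // subsetI subxx /=.
  exact: subset_trans (pcore_sub _ _) (normal_norm nsDM).
exact: subset_trans sDM (gFnorm _ _).
Qed.

Lemma max_p_nilpotent_cap_hypercentral : D / O \subset hypercentre (G / O).
Proof.
have nsDG := max_p_nilpotent_cap_normal.
have nil1: p_nilpotent p [1 gT] := p'group_p_nilpotent (pgroup1 _ _).
have [M maxM _] := max_p_nilpotent_exists (sub1G G) nil1.
have [_ nilM _] := max_p_nilpotentP _ maxM.
have nilD: p_nilpotent p D by apply: p_nilpotentS nilM; apply: bigcap_inf.
apply: (@sub_hypercentre_p'cent _ p) => [||yb]; first exact: quotient_normal.
  move: nilD; rewrite p_nilpotentE p'core_max_p_nilpotent_cap => /and3P[_ _].
  rewrite pnatNK -card_quotient //.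
  by rewrite (subset_trans (normal_sub nsDG)) ?gFnorm.
case/morphimP=> y nOy Gy -> {yb} p'y.
(* A p'-element of G / O is the image of the p'-part of its representative. *)
rewrite -(constt_p_elt p'y) -morph_constt //= -sub1set -quotient_set1 ?groupX //.
rewrite quotient_cents2r // max_p_nilpotent_cap_comm_p'elt ?groupX //.
exact: p_elt_constt.
Qed.

(** Modulo O the p'-core is trivial, so N / O is a hypercentral p-group and its
join with any p-nilpotent subgroup is p-nilpotent; this lifts to G. *)
Lemma hypercentral_sub_max_p_nilpotent_cap N :
    N <| G -> O \subset N -> N / O \subset hypercentre (G / O) -> N \subset D.
Proof.
move=> nsNG sON sNZ; have sNG := normal_sub nsNG.
apply: sub_max_p_nilpotent_cap => // H sHG nilH.
have nOG: G \subset 'N(O) := gFnorm _ _.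
have sNHG: N <*> H \subset G by rewrite join_subG sNG.
rewrite -(@p_nilpotent_pquotient _ _ 'O_p^'(G)) ?pcore_pgroup //=; last first.
  by rewrite /normal (subset_trans sON) ?joing_subl //= (subset_trans sNHG).
rewrite quotientY ?(subset_trans _ nOG) //.
have nsNq: N / O <| G / O by apply: quotient_normal.
apply: (p_nilpotent_joing_hypercentre nsNq) => //; last 2 first.
- exact: quotientS.
- by rewrite p_nilpotent_quotient ?(subset_trans sHG).
by apply: normal_sub_hypercentre_pgroup nsNq _ sNZ; apply: trivg_pcore_quotient.
Qed.

End MaxPNilpotent.

Theorem corollary4p7 (gT : finGroupType) (p : nat) (G : {group gT}) :
  prime p ->
  let D := max_p_nilpotent_cap p G in
  [/\ D <| G,
      'O_p^'(D) = 'O_p^'(G),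
      D / 'O_p^'(G) \subset hypercentre (G / 'O_p^'(G))
    & forall N : {group gT},
        N <| G ->
        'O_p^'(N) = 'O_p^'(G) ->
        N / 'O_p^'(G) \subset hypercentre (G / 'O_p^'(G)) ->
        N \subset D].
Proof.
move=> _ D; split.
- exact: max_p_nilpotent_cap_normal.
- exact: p'core_max_p_nilpotent_cap.
- exact: max_p_nilpotent_cap_hypercentral.
move=> N nsNG eqO; apply: hypercentral_sub_max_p_nilpotent_cap nsNG _.
by rewrite -eqO pcore_sub.
Qed.
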